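(* Let $(w_n)_{n\ge0}$ be nonnegative reals with $W(z)=\sum_{n\ge0}w_nz^n$, and assume there are $\rho_w>0$ and a slowly varying $L_w$ with $w_n\sim L_w(n)n^{-1}\rho_w^{-n}$ and $W(\rho_w)\in(0,\infty)$. Let $X_1,X_2,\dots$ be i.i.d. with probability generating function $W(\rho_w z)/W(\rho_w)$ and $S_k=X_1+\dots+X_k$. For each $n\ge1$ let $k=k(n)$ be a positive integer such that $k\,L_w(n)\to0$. Then, as $n\to\infty$, $$d_{\mathrm{TV}}\Big(\mathcal{L}\big(\tau(X_1,\dots,X_k)\,\big|\,S_k=n\big),\ \mathcal{L}\big((X_1,\dots,X_{k-1})\,\big|\,X_i\le n\ \forall i\le k-1\big)\Big)\to0.$$ Consequently, conditionally on $S_k=n$, $\max(X_1,\dots,X_k)/n\to1$ in probability.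
   Context: The ''delete first maximum'' operator $\tau$ maps $(x_1,\dots,x_k)\in\mathbb{N}_0^k$ to $(x_1,\dots,x_{J-1},x_{J+1},\dots,x_k)\in\mathbb{N}_0^{k-1}$ where $J=\min\{j:x_j=\max_i x_i\}$. $d_{\mathrm{TV}}$ is total variation distance between laws on $\mathbb{N}_0^{k-1}$. *)

(* Defs.v *)
From HB Require Import structures.
From mathcomp Require Import all_boot all_order all_algebra.
From mathcomp Require Import all_classical all_reals all_analysis.
Set Implicit Arguments. Unset Strict Implicit. Unset Printing Implicit Defensive.
Import Order.TTheory GRing.Theory Num.Theory.
Import numFieldNormedType.Exports.
Local Open Scope classical_set_scope.
Local Open Scope ring_scope.

(* Points of N_0^k are represented as sequences of naturals of size k. *)

Definition tau (s : seq nat) : seq nat := rem (\max_(i <- s) i)%N s.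

Definition slowly_varying {R : realType} (L : R -> R) : Prop :=
  exists a : R,
    (forall x, a <= x -> 0 < L x) /\
    measurable_fun `[a, +oo[ L /\
    (forall lam : R, 0 < lam -> (L (lam * x) / L x) @[x --> +oo%R] --> (1 : R)).

Definition Wat {R : realType} (w : nat -> R) (z : R) : R :=
  limn (series (fun n => w n * z ^+ n)).

(* Law of X_1: P(X = j) = w_j rho^j / W(rho), i.e. the coefficients of the
   pgf z |-> W(rho z) / W(rho). *)
Definition pX {R : realType} (w : nat -> R) (rho : R) (j : nat) : R :=
  w j * rho ^+ j / Wat w rho.

(* P(X_1 = x_1, ..., X_m = x_m) for i.i.d. X_i with law p. *)
Definition prodp {R : realType} (p : nat -> R) (s : seq nat) : R :=
  \prod_(i <- s) p i.

Definition tval (k n : nat) (t : k.-tuple 'I_n.+1) : seq nat := map val t.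

(* P(A(X_1..X_k) | S_k = n).  On the event S_k = n every X_i <= n, so the
   sums over k-tuples with entries in {0..n} are the full sums over N_0^k.
   (Convention: 0 if P(S_k = n) = 0.) *)
Definition condSum {R : realType} (p : nat -> R) (k n : nat)
    (A : seq nat -> bool) : R :=
  (\sum_(t : k.-tuple 'I_n.+1 | (sumn (tval t) == n) && A (tval t))
      prodp p (tval t)) /
  (\sum_(t : k.-tuple 'I_n.+1 | sumn (tval t) == n) prodp p (tval t)).

Definition lawTauCond {R : realType} (p : nat -> R) (k n : nat)
    (y : seq nat) : R :=
  condSum p k n (fun x => tau x == y).

Definition lawTrunc {R : realType} (p : nat -> R) (m n : nat)
    (y : seq nat) : R :=
  (if (size y == m) && all (fun a => a <= n)%N y then prodp p y else 0) /
  (\sum_(t : m.-tuple 'I_n.+1) prodp p (tval t)).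

Definition dTV {R : realType} (m : nat) (P Q : seq nat -> R) : \bar R :=
  (2%:R^-1)%:E * \esum_(y in [set y : seq nat | size y = m]) (`|P y - Q y|)%:E.

(* Main.v *)
Require Import Defs.
From HB Require Import structures.
From mathcomp Require Import all_boot all_order all_algebra.
From mathcomp Require Import all_classical all_reals all_analysis.
From mathcomp Require Import ring lra zify.
Import Order.TTheory GRing.Theory Num.Theory.
Import numFieldNormedType.Exports.
Local Open Scope classical_set_scope.
Local Open Scope ring_scope.

(* Write p for the law of X_1, m = k - 1, F = P(X_1 <= n), and s for the total of
   a point y of N_0^m. A point t with total n and tau t = y is y with n - s inserted
   at one of at most k places, so P(tau = y, S_k = n) <= k p(y) p_(n-s), with
   equality if s is small. The uniform convergence theorem for slowly varying
   functions makes p_(n-s) / p_n close to 1 when s <= eps n, so on these y the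
   conditional law is proportional to p(y) up to a factor close to 1.
   It remains to show that the y with s > eps n contribute o(k p_n F^m). They are
   cut into dyadic blocks n / 2^(i+1) < n - s <= n / 2^i. All entries of y are at
   most n - s, so a Chernoff bound for variables truncated at n / 2^i gives the
   block a probability doubly exponentially small in i, uniformly as
   k n p_n tends to 0, whereas p_(n-s) exceeds p_n by a factor O(4^i) only.
   This yields P(S_k = n) ~ k p_n F^m and both limits. *)

(** * Uniform convergence for slowly varying functions *)

(** The pushforward of Lebesgue measure under a translation gives each half-open interval its
    length, and this determines the measure. *)
Lemma lebesgue_measure_shift (R : realType) (c : R) (A : set R) :
  measurable A ->
  @lebesgue_measure R [set x | A (x + c)] = @lebesgue_measure R A.
Proof.
move=> mA.
have mf : measurable_fun [set: measurableTypeR R]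
    ((fun x => x + c) : measurableTypeR R -> measurableTypeR R).
  by apply: measurable_realfun.measurable_funD.
pose f : {mfun measurableTypeR R >-> measurableTypeR R} :=
  @mfun_Sub _ _ (measurableTypeR R) (measurableTypeR R) _ (mem_set mf).
have -> : [set x | A (x + c)] = f @^-1` A by [].
rewrite -[LHS]/(pushforward lebesgue_measure f A).
apply/esym/lebesgue_measure_unique => //= _ [[a b]] _ <-.
rewrite /pushforward.
have -> : f @^-1` `]a, b] = `]a - c, b - c]%classic.
  by apply/seteqP; split=> x /=; rewrite !in_itv/= ltrBlDr lerBrDr.
rewrite !lebesgue_measure_itv/= !lte_fin ltrD2r.
by case: ifP => // _; congr (_%:E); lra.
Qed.

(** Pointwise convergence makes the sets [V N] increase to [0, 2], so continuity from below brings
    their measure above 3/2. That value is half the length of [0, 3], an interval that also holds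
    any translate of such a set by at most 1. *)
Lemma almost_uniform_ratio (R : realType) (g : R -> R) (x : nat -> R) (d : R) :
  measurable_fun setT g -> 0 < d ->
  (forall v, (fun n => g (x n + v) / g (x n)) @ \oo --> (1 : R)) ->
  exists N, let V := [set v : R | 0 <= v <= 2 /\
      forall m, (N <= m)%N -> `|g (x m + v) / g (x m) - 1| < d] in
    measurable V /\ ((3 / 2 : R)%:E < @lebesgue_measure R V)%E.
Proof.
move=> mg d0 hg.
pose V (N : nat) := [set v : R | 0 <= v <= 2 /\
      forall m, (N <= m)%N -> `|g (x m + v) / g (x m) - 1| < d].
have VE N : V N = `[0, 2]%classic `&` \bigcap_(m in [set m | (N <= m)%N])
      [set v | `|g (x m + v) / g (x m) - 1| < d].
  by apply/seteqP; split=> v /=; rewrite in_itv/= => -[h1 h2]; split.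
have mV N : measurable (V N).
  rewrite VE; apply: measurableI; first exact: measurable_itv.
  apply: bigcap_measurable; first by exists N => /=.
  move=> m _.
  have mh : measurable_fun setT (fun v => `|g (x m + v) / g (x m) - 1|).
    apply: measurableT_comp => //.
    apply: measurable_realfun.measurable_funB => //; apply: measurable_realfun.measurable_funM => //.
    apply: (measurableT_comp mg); exact: measurable_realfun.measurable_funD.
  rewrite (_ : [set v | _] = (fun v => `|g (x m + v) / g (x m) - 1|) @^-1` `]-oo, d[).
    by rewrite -[X in measurable X]setTI; apply: mh.
  by apply/seteqP; split=> v /=; rewrite in_itv.
have UV : \bigcup_N V N = `[0, 2]%classic.
  apply/seteqP; split=> v /=.
    by move=> [N _ [h _]]; rewrite in_itv.
  rewrite in_itv/= => h.
  have /cvgrPdist_lt/(_ d d0)[N _ hN] := hg v.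
  exists N => //; split=> // m Nm; rewrite distrC; exact: hN.
have : (fun N => @lebesgue_measure R (V N)) @ \oo --> @lebesgue_measure R `[0, 2]%classic.
  rewrite -UV; apply: nondecreasing_cvg_mu => //.
    exact: bigcupT_measurable.
  move=> n m nm; apply/subsetPset => v [h hv]; split=> // j mj.
  by apply: hv; apply: leq_trans mj.
rewrite lebesgue_measure_itv/= lte_fin ltr0n/= sube0 => hc.
have [|N _ hN] := hc [set y | ((3 / 2 : R)%:E < y)%E].
  apply: open_nbhs_nbhs; split; first exact: open_ereal_gt_ereal.
  by rewrite /= lte_fin; lra.
by exists N; split; [exact: mV|exact: hN (leqnn N)].
Qed.

(** Since b / a = (t / a) / (t / b), the error is at most 2d / (1 - d), and d <= 1/2 turns this into
    4d. *)
Lemma ratio_close (R : realType) (d a b t : R) : 0 < d -> d <= 2^-1 ->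
  0 < a -> 0 < b ->
  `|t / a - 1| < d -> `|t / b - 1| < d -> `|b / a - 1| < 4 * d.
Proof.
move=> d0 d1 a0 b0; rewrite !ltr_norml !ltrBrDr !ltrBlDr.
rewrite !ltr_pdivlMr // !ltr_pdivrMr // => /andP[h1 h2] /andP[h3 h4].
apply/andP; split; nra.
Qed.

(* Two subsets of [0, 3] of measure greater than 3/2 meet; a common point
   compares [g] at both [x n] and [x n + u n]. *)
Lemma uniform_ratio (R : realType) (g : R -> R) (x u : nat -> R) (d : R) :
  measurable_fun setT g -> 0 < d ->
  (forall n, 0 < g (x n)) -> (forall n, 0 < g (x n + u n)) ->
  (forall n, 0 <= u n <= 1) ->
  (forall v, (fun n => g (x n + v) / g (x n)) @ \oo --> (1 : R)) ->
  (forall v, (fun n => g (x n + u n + v) / g (x n + u n)) @ \oo --> (1 : R)) ->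
  exists n, `|g (x n + u n) / g (x n) - 1| < d.
Proof.
move=> mg d0 gx gz hu hx hz.
pose d' := Num.min (2^-1) (d / 4).
have d'0 : 0 < d' by rewrite lt_min; apply/andP; split; lra.
have d'1 : d' <= 2^-1 by rewrite ge_min lexx.
have d'2 : 4 * d' <= d by have : d' <= d / 4 by [rewrite ge_min lexx orbT]; lra.
have [N1 [mV hV]] := almost_uniform_ratio _ _ _ _ mg d'0 hx.
have [N2 [mW hW]] := almost_uniform_ratio _ _ (fun n => x n + u n) _ mg d'0 hz.
set V := (X in measurable X) in mV hV; set W := (X in measurable X) in mW hW.
pose N := maxn N1 N2; exists N.
have mW' : measurable [set s | W (s + - u N)].
  have mf : measurable_fun setT (fun s : R => s + - u N) by exact: measurable_realfun.measurable_funD.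
  by rewrite -[X in measurable X]setTI; exact: mf.
pose W' := [set s | W (s + - u N)].
have muW' : @lebesgue_measure R W' = @lebesgue_measure R W by exact: lebesgue_measure_shift.
have /andP[u0 u1] := hu N.
have [t [Vt Wt]] : V `&` W' !=set0.
  apply/set0P/eqP => VW0.
  have : (@lebesgue_measure R (V `|` W') <= @lebesgue_measure R `[0%R, 3%R]%classic)%E.
    apply: le_measure; rewrite ?inE //; first exact: measurableU.
    move=> s [[/andP[s0 s1] _]|[/andP[s0 s1] _]] /=; rewrite in_itv/=; apply/andP; split; lra.
  rewrite measureU // lebesgue_measure_itv/= lte_fin ltr0n/= sube0.
  apply/negP; rewrite -ltNge.
  have -> : (3 : R)%:E = ((3 / 2 : R)%:E + (3 / 2 : R)%:E)%E by rewrite -EFinD; congr (_%:E); lra.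
  by apply: lteD => //; apply: (lt_le_trans hW); rewrite -muW'.
apply: lt_le_trans d'2.
apply: (@ratio_close _ _ _ _ (g (x N + t))) => //.
  by apply: Vt.2; exact: leq_maxl.
have := Wt.2 N (leq_maxr _ _).
by rewrite (_ : x N + u N + (t - u N) = x N + t) //; lra.
Qed.

(** By contradiction: failures at arbitrarily large x give sequences whose logarithms are [x n] and
    [x n + u n]. With g(s) = L(exp s), slow variation becomes convergence of g(z + v) / g(z) to 1
    along both sequences, and [uniform_ratio] contradicts the failures. *)
Lemma slowly_varying_uniform (R : realType) (L : R -> R) (d : R) :
  slowly_varying L -> 0 < d ->
  exists2 X : R, 0 < X & forall x y, X <= x -> x <= y <= 2 * x ->
    0 < L x /\ `|L y / L x - 1| < d.
Proof.
move=> [a [La [mL hL]]] d0.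
apply: contrapT => /forall2NP H.
have {}H (n : nat) : exists xy : R * R, [/\ n%:R + 1 <= xy.1, `|a| + 1 <= xy.1,
    xy.1 <= xy.2 <= 2 * xy.1 & d <= `|L xy.2 / L xy.1 - 1| ].
  have X0 : 0 < n%:R + `|a| + 1 :> R.
    by have := ler0n R n; have := normr_ge0 a; lra.
  (* The threshold tends to infinity with [n] and also exceeds [a], so positivity of [L] cannot be
     what fails. *)
  have [//|/existsNP[x /existsNP[y /not_implyP[hx /not_implyP[hy]]]]] := H (n%:R + `|a| + 1).
  move=> /not_andP hd; exists (x, y) => /=.
  have nn : 0 <= n%:R :> R by []. have aa := normr_ge0 a.
  split => //; try lra.
  case: hd => [Lx|/negP]; last by rewrite -leNgt.
  by exfalso; apply: Lx; apply: La; have := ler_norm a; lra.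
have {H}[f Hf] := choice H.
pose x n := ln (f n).1; pose u n := ln (f n).2 - ln (f n).1.
have f1 n : 0 < (f n).1 by have [_ h2 _ _] := Hf n; have := normr_ge0 a; lra.
have f2 n : 0 < (f n).2.
  by have := f1 n; have [_ _ /andP[h _] _] := Hf n; lra.
have a1 n : a <= (f n).1 by have [_ h2 _ _] := Hf n; have := ler_norm a; lra.
have a2 n : a <= (f n).2.
  by have := a1 n; have [_ _ /andP[h _] _] := Hf n; lra.
(* [L] is known to be measurable on [a, +oo[ only; extending it by zero gives a function measurable
   everywhere and agrees with it at every point used. *)
pose g : R -> R := fun s => (L \_ `[a, +oo[) (expR s).
have gE s : a <= expR s -> g s = L (expR s).
  by move=> h; rewrite /g /= patchE mem_set //= in_itv/= andbT.
have mg : measurable_fun setT g.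
  have ma : measurable (`[a, +oo[%classic : set R) by exact: measurable_itv.
  have mLa : measurable_fun setT (L \_ `[a, +oo[) by exact/(measurable_restrictT _ ma).
  by apply: (measurableT_comp mLa).
have ex n : expR (x n) = (f n).1 by rewrite lnK // posrE.
have ez n : expR (x n + u n) = (f n).2 by rewrite /x /u addrC subrK lnK // posrE.
have cvgg (z : nat -> R) : (forall n, n%:R + 1 <= expR (z n)) ->
    (forall n, a <= expR (z n)) ->
    forall v, (fun n => g (z n + v) / g (z n)) @ \oo --> (1 : R).
  move=> hz hza v.
  have zoo : (fun n => expR (z n)) @ \oo --> +oo.
    apply/cvgryPge => A; near=> n; apply: le_trans (hz n).
    by rewrite -lerBlDr; near: n; exact: nbhs_infty_ger.
  have h := cvg_comp _ _ zoo (hL _ (expR_gt0 v)).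
  apply: cvg_trans h; apply: near_eq_cvg; near=> n.
  rewrite (gE (z n)) // (gE (z n + v)) expRD [_ * expR v]mulrC //.
  rewrite -ler_pdivrMl ?expR_gt0 //; near: n.
  by have /cvgryPge := zoo; apply.
have [|||||n] := @uniform_ratio _ g x u d mg d0.
- by move=> n; rewrite gE ex //; exact: La.
- by move=> n; rewrite gE ez //; exact: La.
(* The shift is at most 1 because the ratio of the two points is at most 2 <= exp 1. *)
- move=> n; have [_ _ /andP[h1 h2] _] := Hf n; rewrite /u subr_ge0 ler_ln ?posrE // h1/=.
  rewrite lerBlDr -ler_expR expRD !lnK ?posrE //; apply: (le_trans h2).
  rewrite ler_wpM2r ?(ltW (f1 n)) //.
  by have := expR_ge1Dx (1 : R); lra.
- by apply: cvgg => n; rewrite ex //; have [] := Hf n.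
- by apply: cvgg => n; rewrite ez //; have [h1 _ /andP[h2 _] _] := Hf n; lra.
by rewrite !gE ?ex ?ez // ltNge => /negP; apply; have [] := Hf n.
Unshelve. all: by end_near. Qed.

(** * Sequences [p] with [n * p n] slowly varying *)

(** Strong induction on [n]: the bound at [uphalf n] contributes at most (3/4) C g(n), which leaves
    C / 4 to absorb K. *)
Lemma le_of_halving (R : realType) (f g : nat -> R) (N : nat) (K : R) :
  0 <= K -> (forall n, 0 <= f n) -> (forall n, 0 <= g n) ->
  (forall n, (N <= n)%N -> 0 < g n) ->
  (forall n, (N <= n)%N -> f n <= f (uphalf n) + K * g n) ->
  (forall n, (N <= n)%N -> g (uphalf n) <= 3 / 4 * g n) ->
  exists2 C : R, 0 < C & forall n, (N <= n)%N -> f n <= C * g n.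
Proof.
move=> K0 f0 g0 gN fh gh.
(* The sum covers the finitely many [n] for which halving may fall below [N], the term 4K closes the
   induction, and 1 makes C positive. *)
pose C := \sum_(n < (N.+2).*2) f n / g n + 4 * K + 1.
have S0 : 0 <= \sum_(n < (N.+2).*2) f n / g n by apply: sumr_ge0 => i _; rewrite divr_ge0.
exists C; first by rewrite /C; lra.
elim/ltn_ind => n IH Nn.
have gn := gN _ Nn.
have [nN|nN] := ltnP n (N.+2).*2.
  rewrite -ler_pdivrMr //; apply: (@le_trans _ _ (\sum_(n < (N.+2).*2) f n / g n)).
    rewrite (bigD1 (Ordinal nN)) //= lerDl; apply: sumr_ge0 => i _; rewrite divr_ge0 //.
  by rewrite /C; lra.
apply: (le_trans (fh _ Nn)).
have h1 : f (uphalf n) <= C * g (uphalf n) by apply: IH; lia.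
have h2 : C * g (uphalf n) <= C * (3 / 4 * g n).
  by apply: ler_wpM2l; [rewrite /C; lra|exact: gh].
have h3 : 4 * K <= C by rewrite /C; lra.
have h4 : 4 * K * g n <= C * g n by rewrite ler_pM2r.
nra.
Qed.

(* [n * p n] is slowly varying along integers, uniformly on [[n / 2, n]]. *)
Definition nearly_harmonic {R : realType} (p : nat -> R) : Prop :=
  forall d : R, 0 < d -> exists N : nat, forall n, (N <= n)%N -> 0 < p n /\
    forall j, (j <= n <= j.*2)%N ->
      `|j%:R * p j - n%:R * p n| <= d * (n%:R * p n).

(** The first factor tends to 1, so n p_n is asymptotic to L(n) / W(rho). This serves both the
    regularity of p and the limit of k n p_n. *)
Lemma pX_eventuallyE (R : realType) (w : nat -> R) (rho : R) (L : R -> R) :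
  0 < rho -> slowly_varying L -> 0 < Wat w rho ->
  exists N : nat, forall n, (N <= n)%N -> 0 < L n%:R /\ n%:R * pX w rho n =
    w n / (L n%:R * n%:R^-1 * rho ^- n) * L n%:R / Wat w rho.
Proof.
move=> rho0 [a [La _]] W0; exists (Num.truncn `|a|).+1 => n hn.
have an : `|a| <= n%:R by apply/ltW/(lt_le_trans (truncnS_gt _)); rewrite ler_nat.
have Ln : 0 < L n%:R by apply: La; exact: le_trans (ler_norm a) an.
split => //; rewrite /pX.
have n0 : 0 < n%:R :> R by rewrite ltr0n; lia.
have := exprn_gt0 n rho0; move: (rho ^+ n) => q q0.
by field; rewrite !gt_eqF.
Qed.

Lemma pX_nearly_harmonic (R : realType) (w : nat -> R) (rho : R) (L : R -> R) :
  0 < rho -> slowly_varying L ->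
  (fun n => w n / (L n%:R * n%:R^-1 * rho ^- n)) @ \oo --> (1 : R) ->
  0 < Wat w rho -> nearly_harmonic (pX w rho).
Proof.
move=> rho0 svL hr W0 d d0.
pose r n := w n / (L n%:R * n%:R^-1 * rho ^- n).
(* The bound 1/4 keeps the product [a * q] below above 1/2; d / 8 then makes the accumulated error
   4e at most d times that product. *)
pose e := Num.min (4^-1) (d / 8).
have e0 : 0 < e by rewrite lt_min; apply/andP; split; lra.
have e1 : e <= 4^-1 by rewrite ge_min lexx.
have e2 : e <= d / 8 by rewrite ge_min lexx orbT.
clearbody e.
have [X X0 hX] := slowly_varying_uniform _ L e svL e0.
have /cvgrPdist_lt/(_ e e0)[N1 _ hN1] := hr.
pose N2 := (Num.truncn X).+1.
have hN2 n : (N2 <= n)%N -> X <= n%:R.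
  move=> h; apply/ltW/(lt_le_trans (truncnS_gt X)).
  by rewrite ler_nat.
have [N3 hN3] := pX_eventuallyE _ w rho L rho0 svL W0.
(* Doubling the threshold puts every j >= n / 2 beyond the three bounds as well. *)
exists (maxn N1 (maxn N2 N3)).*2 => n hn.
have big j : (n <= j.*2)%N -> [/\ (N1 <= j)%N, (N2 <= j)%N & (N3 <= j)%N] by move=> ?; split; lia.
have est j : (N1 <= j)%N -> `|r j - 1| < e by move=> h; rewrite distrC; exact: hN1.
have [n1 n2 n3] := big n ltac:(lia).
have [Ln un] := hN3 n n3.
have rn := est n n1.
split.
  have : 0 < n%:R * pX w rho n.
    have r0 : 0 < r n by move: rn; rewrite ltr_norml => /andP[]; lra.
    by rewrite un -/(r n) divr_gt0 // mulr_gt0.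
  by rewrite pmulr_rgt0 // ltr0n; exact: leq_trans n2.
move=> j /andP[jn nj]; have [j1 j2 j3] := big j nj.
have [Lj uj] := hN3 j j3.
have rj := est j j1.
have hL := (hX j%:R n%:R (hN2 _ j2) _).2.
have {hL} : `|L n%:R / L j%:R - 1| < e.
  by apply: hL; rewrite ler_nat jn /= -natrM ler_nat mul2n.
rewrite uj un -/(r j) -/(r n) => hq; move: rn rj => hn' hj'; set Ljj := L j%:R in hq *.
have -> : L n%:R = (L n%:R / Ljj) * Ljj by rewrite divfK // gt_eqF.
move: (L n%:R / Ljj) hq => q hq.
have -> : r j * Ljj / Wat w rho - r n * (q * Ljj) / Wat w rho =
  (r j - r n * q) * (Ljj / Wat w rho) by ring.
have -> : d * (r n * (q * Ljj) / Wat w rho) = (d * (r n * q)) * (Ljj / Wat w rho) by ring.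
have LW : 0 < Ljj / Wat w rho by rewrite divr_gt0.
rewrite normrM (gtr0_norm LW) ler_pM2r //.
move: hn' hj' hq; move: (r n) (r j) => a b.
rewrite !ltr_norml ler_norml => /andP[a1 a2] /andP[b1 b2] /andP[q1 q2].
have aq2 : (1 - e) * (1 - e) <= a * q by apply: ler_pM; lra.
have aq1 : a * q <= (1 + e) * (1 + e) by apply: ler_pM; lra.
have ee : 0 <= e * e <= 4^-1 * e by apply/andP; split; nra.
have aq3 : 2^-1 <= a * q by lra.
have de : 4 * e <= d * (a * q) by nra.
apply/andP; split; lra.
Qed.

Section nearly_harmonic_theory.
Variables (R : realType) (p : nat -> R).
Hypotheses (p0 : forall n, 0 <= p n) (hp : nearly_harmonic p).

Lemma nearly_harmonic_gt0 : exists N : nat, forall n, (N <= n)%N -> 0 < p n.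
Proof. by have [N hN] := hp _ ltr01; exists N => n /hN[]. Qed.

(** Here n^2 p_n is n times a slowly varying factor. For n >= 5 the index [uphalf n] is at most
    3n/5, and tolerance 1/4 in [nearly_harmonic] costs 5/4, whence the factor 3/4. *)
Let halving_setup : exists N : nat, forall n, (N <= n)%N -> [/\ 0 < n%:R ^+ 2 * p n,
  (uphalf n)%:R ^+ 2 * p (uphalf n) <= 3 / 4 * (n%:R ^+ 2 * p n) &
  forall j, (uphalf n <= j <= n)%N -> j%:R * p j <= 2 * (n%:R * p n)].
Proof.
have d0 : 0 < 4^-1 :> R by lra.
have [N hN] := hp _ d0; exists (N + 5)%N => n hn.
have [|pn hj] := hN n; first lia.
have n5 : 5 <= n%:R :> R by rewrite (ler_nat _ 5); lia.
have key j : (uphalf n <= j <= n)%N -> j%:R * p j <= 5 / 4 * (n%:R * p n).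
  move=> h; have := hj j; rewrite ler_norml => /(_ _)/andP[|_]; first by lia.
  lra.
have up0 : 0 <= n%:R * p n by rewrite mulr_ge0.
split; first by rewrite mulr_gt0 // exprn_gt0 //; lra.
  have h1 := key (uphalf n); have {}h1 := h1 ltac:(lia).
  have h2 : (uphalf n)%:R <= 3 / 5 * n%:R :> R.
    have : 2 * (uphalf n)%:R <= n%:R + 1 :> R.
      by rewrite -natrM natr1 ler_nat; lia.
    lra.
  rewrite !expr2 -!mulrA.
  apply: (@le_trans _ _ (3 / 5 * n%:R * (5 / 4 * (n%:R * p n)))); last lra.
  by apply: ler_pM => //; rewrite mulr_ge0.
by move=> j /key; lra.
Qed.

(** Halving applied to the running maximum: indices above [uphalf n] contribute at most 2 n^2 p_n.
    It yields p_(n-s) = O((n / (n-s))^2 p_n), the source of the powers of 4 in the dyadic blocks. *)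
Lemma nearly_harmonic_le : exists2 C : R, 0 < C & exists N : nat,
  forall n j, (N <= n)%N -> (j <= n)%N -> j%:R ^+ 2 * p j <= C * (n%:R ^+ 2 * p n).
Proof.
have [N hN] := halving_setup.
pose f n := \big[Num.max/0]_(j < n.+1) (j%:R ^+ 2 * p j).
have fj n j : (j <= n)%N -> j%:R ^+ 2 * p j <= f n.
  move=> jn; pose jo : 'I_n.+1 := Ordinal (jn : (j < n.+1)%N).
  exact: (le_bigmax 0 (fun i : 'I_n.+1 => i%:R ^+ 2 * p i) jo).
have g0 n : 0 <= n%:R ^+ 2 * p n by rewrite mulr_ge0 // exprn_ge0.
have f0 n : 0 <= f n by apply: le_trans (fj n n (leqnn n)).
have [||||C C0 hC] := @le_of_halving R f (fun n => n%:R ^+ 2 * p n) N 2 _ f0 g0.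
- by [].
- by move=> n /hN[].
- move=> n /hN[h1 h2 h3]; apply: bigmax_le; first by rewrite addr_ge0 ?mulr_ge0.
  move=> [j /= jn] _; have [h|h] := leqP j (uphalf n).
    by apply: (le_trans (fj _ _ h)); rewrite lerDl mulr_ge0.
  apply: (@le_trans _ _ (2 * (n%:R ^+ 2 * p n))); last by rewrite lerDr.
  rewrite !expr2 -!mulrA [2 * _]mulrCA; apply: ler_pM => //.
  - by rewrite mulr_ge0.
  - by rewrite ler_nat.
  - by apply: h3; lia.
- by move=> n /hN[].
by exists C => //; exists N => n j Nn jn; apply: (le_trans (fj _ _ jn)); exact: hC.
Qed.

(** Halving applied to the first moment truncated at n: the upper half has at most n terms, each at
    most 2 n p_n. The Chernoff bound uses this moment. *)
Lemma nearly_harmonic_sum : exists2 C : R, 0 < C & exists N : nat,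
  forall n, (N <= n)%N -> \sum_(j < n.+1) j%:R * p j <= C * (n%:R ^+ 2 * p n).
Proof.
have [N hN] := halving_setup.
pose f n := \sum_(j < n.+1) j%:R * p j.
have g0 n : 0 <= n%:R ^+ 2 * p n by rewrite mulr_ge0 // exprn_ge0.
have f0 n : 0 <= f n by apply: sumr_ge0 => i _; rewrite mulr_ge0.
have [||||C C0 hC] := @le_of_halving R f (fun n => n%:R ^+ 2 * p n) N 2 _ f0 g0.
- by [].
- by move=> n /hN[].
- move=> n /hN[h1 h2 h3].
  have un : (uphalf n <= n)%N by lia.
  rewrite /f -!(big_mkord xpredT (fun j => j%:R * p j)).
  rewrite (big_cat_nat (n := (uphalf n).+1)) //= lerD2l.
  apply: (@le_trans _ _ (\sum_((uphalf n).+1 <= i < n.+1) 2 * (n%:R * p n))).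
    by rewrite big_nat [leRHS]big_nat; apply: ler_sum => j hj; apply: h3; lia.
  have -> : n%:R ^+ 2 * p n = n%:R * (n%:R * p n) by rewrite expr2 mulrA.
  rewrite sumr_const_nat -[leLHS]mulr_natl [leRHS]mulrCA.
  by apply: ler_wpM2r; [rewrite !mulr_ge0|rewrite ler_nat; lia].
- by move=> n /hN[].
by exists C => //; exists N.
Qed.

(** With s <= n/4 the indices n - s and n are within a factor 2, so (n-s) p_(n-s) is close to n p_n;
    replacing n - s by n costs a factor absorbed by eps <= d/4. *)
Lemma nearly_harmonic_local (d : R) : 0 < d ->
  exists2 eps : R, 0 < eps <= 4^-1 & exists N : nat, forall n s, (N <= n)%N ->
    s%:R <= eps * n%:R -> (1 - d) * p n <= p (n - s)%N <= (1 + d) * p n.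
Proof.
move=> d0; pose eps := Num.min (4^-1) (d / 4).
have e0 : 0 < eps by rewrite lt_min; apply/andP; split; lra.
have e1 : eps <= 4^-1 by rewrite ge_min lexx.
have e2 : eps <= d / 4 by rewrite ge_min lexx orbT.
clearbody eps.
exists eps; first by rewrite e0.
have d4 : 0 < d / 4 by lra.
have [N hN] := hp _ d4; exists N.+1 => n s Nn hs.
have n0 : 0 < n%:R :> R by rewrite ltr0n; lia.
have sn4 : (4 * s <= n)%N.
  rewrite -(ler_nat R) natrM.
  have : eps * n%:R <= 4^-1 * n%:R by rewrite ler_pM2r.
  by lra.
have sn : (s <= n)%N by lia.
have [|pn /(_ (n - s)%N)] := hN n; first lia.
rewrite natrB //; move: (p (n - s)%N) (p0 (n - s)%N) => q q0.
rewrite ler_norml => /(_ _)/andP[|h1 h2]; first lia.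
have s0 : 0 <= s%:R :> R by [].
have se : s%:R <= d / 4 * n%:R by apply: (le_trans hs); rewrite ler_pM2r.
have sn4' : s%:R <= 4^-1 * n%:R :> R by apply: (le_trans hs); rewrite ler_pM2r.
have np : 0 < n%:R * p n by rewrite mulr_gt0.
apply/andP; split.
  rewrite -(ler_pM2l n0).
  have : (n%:R - s%:R) * q <= n%:R * q by rewrite ler_wpM2r //; lra.
  nra.
have ns0 : 0 < n%:R - s%:R :> R by lra.
rewrite -(ler_pM2l ns0).
apply: (@le_trans _ _ ((1 + d / 4) * (n%:R * p n))); first lra.
rewrite [leRHS](_ : _ = (n%:R - s%:R) * (1 + d) * p n); last by ring.
rewrite mulrA ler_pM2r //.
nra.
Qed.

End nearly_harmonic_theory.

(** * Inserting a first maximum *)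

(* [tval] now denotes the projection of the MathComp tuples. *)
Local Notation nval := Defs.tval.

Lemma size_nval (k n : nat) (t : k.-tuple 'I_n.+1) : size (nval t) = k.
Proof. by rewrite size_map size_tuple. Qed.

Lemma nval_le (k n : nat) (t : k.-tuple 'I_n.+1) : all (fun a => a <= n)%N (nval t).
Proof. by apply/allP => a /mapP[i _ ->]; exact: leq_ord. Qed.

Lemma nval_inj (k n : nat) : injective (@nval k n).
Proof. by move=> s t h; apply/val_inj; apply: (inj_map val_inj) h. Qed.

Lemma nval_surj (k n : nat) (s : seq nat) : size s = k ->
  all (fun a => a <= n)%N s -> exists t : k.-tuple 'I_n.+1, nval t = s.
Proof.
move=> sk /allP sn.
have h : size [seq inord i : 'I_n.+1 | i <- s] == k by rewrite size_map sk.
exists (Tuple h); rewrite /nval /= -map_comp map_id_in // => i /sn /= hi.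
by rewrite inordK.
Qed.

Lemma sum_tuple_cons (R : nmodType) (A : finType) (k : nat) (F : k.+1.-tuple A -> R) :
  \sum_(t : k.+1.-tuple A) F t = \sum_(a : A) \sum_(t : k.-tuple A) F [tuple of a :: t].
Proof.
rewrite pair_big /=.
rewrite (reindex (fun q : A * k.-tuple A => [tuple of q.1 :: q.2])) //=.
exists (fun t : k.+1.-tuple A => (thead t, [tuple of behead t])).
  by move=> [a t] _ /=; congr (_, _); apply: val_inj.
by move=> t _; rewrite [t in RHS]tuple_eta /=; apply: val_inj.
Qed.

Lemma sum_prodp_nval (R : realType) (f : nat -> R) (k n : nat) :
  \sum_(t : k.-tuple 'I_n.+1) prodp f (nval t) = (\sum_(j < n.+1) f j) ^+ k.
Proof.
elim: k => [|k IH].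
  rewrite (big_pred1 [tuple]) => [|t]; first by rewrite /prodp big_nil expr0.
  by apply/esym/eqP; exact: tuple0.
rewrite sum_tuple_cons exprS mulr_suml; apply: eq_bigr => a _.
by rewrite -IH mulr_sumr; apply: eq_bigr => t _; rewrite /prodp big_cons.
Qed.

Lemma prodp_ge0 (R : realType) (p : nat -> R) (s : seq nat) :
  (forall n, 0 <= p n) -> 0 <= prodp p s.
Proof. by move=> p0; apply: prodr_ge0. Qed.

Lemma leq_bigmax_seq_nat (s : seq nat) (i : nat) : i \in s -> (i <= \max_(j <- s) j)%N.
Proof. by move=> h; rewrite (big_rem _ h) leq_maxl. Qed.

Lemma leq_sumn (s : seq nat) (i : nat) : i \in s -> (i <= sumn s)%N.
Proof. by elim: s => //= b r IH; rewrite inE => /orP[/eqP->|/IH]; lia. Qed.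

Lemma bigmax_mem (s : seq nat) : (0 < size s)%N -> (\max_(j <- s) j)%N \in s.
Proof.
elim: s => [//|a [_ _|b s IH _]]; first by rewrite big_seq1 inE.
rewrite big_cons; have := IH isT; set M := bigop _ _ _ => hM.
by rewrite inE /maxn; case: ifP => _; rewrite ?hM ?orbT // eqxx.
Qed.

Lemma rem_insert (T : eqType) (x : T) (s : seq T) (i : nat) : x \notin s ->
  rem x (take i s ++ x :: drop i s) = s.
Proof.
move=> xs; rewrite -[RHS](cat_take_drop i).
have : x \notin take i s by apply: contra xs; exact: mem_take.
elim: (take i s) => [|a r IH] /=; first by rewrite eqxx.
by rewrite inE negb_or eq_sym => /andP[/negbTE -> /IH ->].
Qed.

Lemma insert_rem (T : eqType) (x : T) (s : seq T) : x \in s ->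
  s = take (index x s) (rem x s) ++ x :: drop (index x s) (rem x s).
Proof.
elim: s => [//|a s IH] /=; rewrite inE eq_sym.
by case: eqVneq => [-> _|_ /= /IH {1}->] //=; rewrite take0 drop0.
Qed.

Lemma index_insert (T : eqType) (x : T) (s : seq T) (i : nat) : x \notin s ->
  (i <= size s)%N -> index x (take i s ++ x :: drop i s) = i.
Proof.
move=> xs si; rewrite index_cat (negbTE (contra (@mem_take i T s x) xs)) /= eqxx addn0.
by rewrite size_takel.
Qed.

Lemma sumn_insert (x : nat) (s : seq nat) (i : nat) :
  sumn (take i s ++ x :: drop i s) = (x + sumn s)%N.
Proof. by rewrite sumn_cat /= addnCA -sumn_cat cat_take_drop. Qed.

Lemma sumn_tau (s : seq nat) : (0 < size s)%N ->
  sumn s = (\max_(j <- s) j + sumn (tau s))%N.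
Proof. by move=> /bigmax_mem h; rewrite [in LHS](insert_rem _ _ _ h) sumn_insert. Qed.

Lemma prodp_tau (R : realType) (p : nat -> R) (s : seq nat) : (0 < size s)%N ->
  prodp p s = prodp p (tau s) * p (\max_(j <- s) j)%N.
Proof.
by move=> /bigmax_mem h; rewrite {1}/prodp (perm_big _ (perm_to_rem h)) big_cons mulrC.
Qed.

(* Number of ways of inserting a first maximum into [y] so as to get total [n]. *)
Definition ninsert (m n : nat) (y : seq nat) : nat :=
  #|[pred t : m.+1.-tuple 'I_n.+1 | (sumn (nval t) == n) && (tau (nval t) == y)]|.

Section ninsert_theory.
Variables m n : nat.

Let max_tauE (t : m.+1.-tuple 'I_n.+1) : sumn (nval t) = n ->
  (\max_(j <- nval t) j = n - sumn (tau (nval t)))%N.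
Proof.
by move=> h; have := sumn_tau (nval t); rewrite size_nval h => /(_ isT); lia.
Qed.

Let tvalE (t : m.+1.-tuple 'I_n.+1) (y : seq nat) (M := (\max_(j <- nval t) j)%N) :
  tau (nval t) = y -> nval t = take (index M (nval t)) y ++ M :: drop (index M (nval t)) y.
Proof.
by move=> <-; apply: insert_rem; apply: bigmax_mem; rewrite size_nval.
Qed.

(** The deleted maximum must equal n - [sumn y], so a tuple in the fibre is determined by the
    position of its first maximum. *)
Lemma ninsert_le (y : seq nat) : (ninsert m n y <= m.+1)%N.
Proof.
pose f (t : m.+1.-tuple 'I_n.+1) : 'I_m.+1 := inord (index (n - sumn y)%N (nval t)).
rewrite -[X in (_ <= X)%N]card_ord /ninsert -(card_in_imset (f := f)).
  exact: max_card.
move=> s t /andP[/eqP ss /eqP ts] /andP[/eqP st /eqP tt].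
have Ms := max_tauE _ ss; have Mt := max_tauE _ st.
have es := tvalE _ _ ts; have et := tvalE _ _ tt.
rewrite Ms ts in es; rewrite Mt tt in et.
have lt_index (u : m.+1.-tuple 'I_n.+1) : sumn (nval u) = n -> tau (nval u) = y ->
    (index (n - sumn y) (nval u) < m.+1)%N.
  move=> su tu; rewrite -[X in (_ < X)%N](size_nval m.+1 n u) index_mem.
  by rewrite -tu -(max_tauE _ su) bigmax_mem // size_nval.
move=> /(congr1 val); rewrite /= !inordK ?lt_index // => e.
by apply: nval_inj; rewrite es et e.
Qed.

(** No remaining entry can exceed the deleted maximum n - [sumn y]. This truncation of the entries
    is what the Chernoff bound exploits. *)
Lemma ninsert_gt0 (y : seq nat) : (0 < ninsert m n y)%N ->
  (sumn y <= n)%N /\ all (fun a => a <= n - sumn y)%N y.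
Proof.
move=> /card_gt0P[t /andP[/eqP st /eqP tt]].
have sz : (0 < size (nval t))%N by rewrite size_nval.
have e := sumn_tau _ sz; rewrite st tt in e.
split; first by rewrite [leqRHS]e leq_addl.
apply/allP => a; rewrite -tt => /mem_rem /leq_bigmax_seq_nat.
by rewrite (max_tauE _ st).
Qed.

(** The inserted value is then a strict maximum absent from [y]: each position is admissible, and
    the position can be read off as its index. *)
Lemma ninsert_full (y : seq nat) : size y = m -> (sumn y <= n)%N ->
  all (fun a => a < n - sumn y)%N y -> ninsert m n y = m.+1.
Proof.
move=> sy sn /allP ya; apply/eqP; rewrite eqn_leq ninsert_le /=.
set x := (n - sumn y)%N in ya.
have xy : x \notin y by apply/negP => /ya; rewrite ltnn.
have /choice[f hf] : forall i : 'I_m.+1, exists t : m.+1.-tuple 'I_n.+1,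
    nval t = take i y ++ x :: drop i y.
  move=> i; apply: nval_surj.
    by rewrite size_cat /= addnS -size_cat cat_take_drop sy.
  apply/allP => a; rewrite mem_cat inE => h.
  suff: a \in x :: y by rewrite inE => /orP[/eqP->|/ya/ltnW h']; [exact: leq_subr|apply: (leq_trans h'); exact: leq_subr].
  rewrite inE; case/or3P: h => [/mem_take ->|->|/mem_drop ->] //; exact: orbT.
have finj : injective f.
  move=> i j /(congr1 (fun t => index x (nval t))); rewrite !hf !index_insert ?sy -1?ltnS //.
  exact: val_inj.
rewrite -[X in (X <= _)%N]card_ord -(card_imset _ finj) /ninsert.
apply/subset_leq_card/fintype.subsetP => t /imsetP[i _ ->]; rewrite inE hf sumn_insert subnK // eqxx /=.
suff M : (\max_(j <- take i y ++ x :: drop i y) j)%N = x by rewrite /tau M rem_insert.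
apply/eqP; rewrite eqn_leq; apply/andP; split; last first.
  by apply: leq_bigmax_seq_nat; rewrite mem_cat inE eqxx orbT.
apply/bigmax_leqP_seq => a; rewrite mem_cat inE => /or3P[/mem_take/ya/ltnW|/eqP->|/mem_drop/ya/ltnW] //.
Qed.

Lemma sum_tau_fiber (R : realType) (p : nat -> R) (y : seq nat) :
  \sum_(t : m.+1.-tuple 'I_n.+1 | (sumn (nval t) == n) && (tau (nval t) == y))
     prodp p (nval t) = (ninsert m n y)%:R * (prodp p y * p (n - sumn y)%N).
Proof.
rewrite (eq_bigr (fun=> prodp p y * p (n - sumn y)%N)) => [|t /andP[/eqP st /eqP tt]].
  by rewrite sumr_const mulr_natl.
by rewrite prodp_tau ?size_nval // (max_tauE _ st) tt.
Qed.

(** On the fibre over y the maximum is n - [sumn y], so a condition [B] on the maximum becomes one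
    on y. The trivial [B] gives P(S_k = n); another gives the deviation of the maximum. *)
Lemma sum_tau_fibers (R : realType) (p : nat -> R) (B : pred nat) :
  \sum_(t : m.+1.-tuple 'I_n.+1 |
       (sumn (nval t) == n) && B (\max_(j <- nval t) j)%N) prodp p (nval t) =
  \sum_(y : m.-tuple 'I_n.+1 | B (n - sumn (nval y))%N)
     (ninsert m n (nval y))%:R * (prodp p (nval y) * p (n - sumn (nval y))%N).
Proof.
have /choice[h hE] : forall t : m.+1.-tuple 'I_n.+1, exists y : m.-tuple 'I_n.+1,
    nval y = tau (nval t).
  move=> t; apply: nval_surj.
    by rewrite size_rem ?size_nval // bigmax_mem // size_nval.
  by apply/allP => a /mem_rem; move: a; apply/allP; exact: nval_le.
rewrite (partition_big h (fun y => B (n - sumn (nval y))%N)) => [|t /andP[/eqP st]]; last first.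
  by rewrite hE (max_tauE _ st).
apply: eq_bigr => y By; rewrite -sum_tau_fiber; apply: eq_bigl => t.
have -> : (h t == y) = (tau (nval t) == nval y).
  by rewrite -hE (inj_eq (@nval_inj m n)).
case: eqP => //= st; case: eqP => /= [tt|]; rewrite ?andbF ?andbT //.
by rewrite (max_tauE _ st) tt.
Qed.

End ninsert_theory.

(** * Tuples with a large sum *)

(** From 1 - x <= exp(-x) comes exp(lam t) <= 1 + t lam exp(lam t), and lam exp(lam t) <= exp(2
    lam). Linearity in t reduces exponential moments to the first moment. *)
Lemma expR_le_chord (R : realType) (lam t : R) : 0 <= lam -> 0 <= t <= 1 ->
  expR (lam * t) <= 1 + t * expR (2 * lam).
Proof.
move=> lam0 /andP[t0 t1].
have h1 : 1 - lam * t <= expR (- (lam * t)) by exact: expR_ge1Dx.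
have h2 : (1 - lam * t) * expR (lam * t) <= 1.
  by rewrite -[leRHS](expRxMexpNx_1 (lam * t)) mulrC ler_wpM2l ?expR_ge0.
have h3 : expR (lam * t) <= expR lam by rewrite ler_expR ler_piMr.
have h4 : lam <= expR lam by have := expR_ge1Dx lam; lra.
have h5 : lam * expR (lam * t) <= expR (2 * lam).
  rewrite (_ : 2 * lam = lam + lam); last by ring.
  by rewrite expRD ler_pM // expR_ge0.
have h6 : t * (lam * expR (lam * t)) <= t * expR (2 * lam) by rewrite ler_wpM2l.
nra.
Qed.

Section truncated_chernoff.
Variables (R : realType) (p : nat -> R) (m n : nat).
Hypothesis p0 : forall j, 0 <= p j.
Let F := \sum_(j < n.+1) p j.
Let M := \sum_(j < n.+1) j%:R * p j.

(** Exponential Markov inequality with tilt lam / h: the truncated tilted weights [f] factor over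
    the coordinates, and their sum is at most F + exp(2 lam) M / h, hence at most F times an
    exponential. *)
Lemma truncated_chernoff (lam h x : R) : 0 <= lam -> 0 < h -> 0 < F ->
  \sum_(y : m.-tuple 'I_n.+1 | (x <= (sumn (nval y))%:R) &&
      all (fun a => a%:R <= h) (nval y)) prodp p (nval y) <=
  F ^+ m * expR (m%:R * (expR (2 * lam) * (M / h) / F) - lam * (x / h)).
Proof.
move=> lam0 h0 F0.
pose f (j : nat) : R := if j%:R <= h then p j * expR (lam * (j%:R / h)) else 0.
have f0 j : 0 <= f j by rewrite /f; case: ifP => // _; rewrite mulr_ge0 ?expR_ge0.
have fp (s : seq nat) : all (fun a => a%:R <= h) s ->
    prodp f s = prodp p s * expR (lam * ((sumn s)%:R / h)).
  rewrite /prodp; elim: s => [|a s IH] /=; first by rewrite !big_nil mul0r mulr0 expR0 mulr1.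
  move=> /andP[ah /IH e]; rewrite !big_cons e {1}/f ah natrD mulrDl mulrDr expRD.
  by rewrite mulrACA.
apply: (@le_trans _ _ (expR (- (lam * (x / h))) *
    \sum_(y : m.-tuple 'I_n.+1) prodp f (nval y))).
  rewrite mulr_sumr big_mkcond /=; apply: ler_sum => y _.
  case: ifP => [/andP[xs yh]|_]; last by rewrite mulr_ge0 ?expR_ge0 ?prodp_ge0.
  rewrite fp // mulrCA -expRD ler_peMr ?prodp_ge0 //.
  rewrite -[leLHS]expR0 ler_expR addrC -mulrBr -mulrBl mulr_ge0 // divr_ge0 ?subr_ge0 //.
  exact: ltW.
rewrite sum_prodp_nval expRD [leRHS]mulrA [leRHS]mulrC ler_pM2l ?expR_gt0 //.
apply: (@le_trans _ _ ((F * expR (expR (2 * lam) * (M / h) / F)) ^+ m)); last first.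
  by rewrite exprMn -expRM_natl.
apply: lerXn2r; rewrite ?nnegrE; first exact: sumr_ge0.
  by rewrite mulr_ge0 ?expR_ge0 // ltW.
apply: (@le_trans _ _ (F + expR (2 * lam) * (M / h))).
  rewrite /M mulr_suml mulr_sumr -big_split /=; apply: ler_sum => j _.
  rewrite /f; case: ifP => [jh|_]; last first.
    by rewrite addr_ge0 // !mulr_ge0 ?expR_ge0 ?invr_ge0 // ltW.
  have jh1 : 0 <= j%:R / h <= 1.
    by apply/andP; split; [apply: divr_ge0 => //; exact: ltW|rewrite ler_pdivrMr // mul1r].
  apply: (@le_trans _ _ (p j * (1 + j%:R / h * expR (2 * lam)))).
    by rewrite ler_wpM2l // expR_le_chord.
  by rewrite le_eqVlt; apply/orP; left; apply/eqP; field; rewrite gt_eqF.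
have := expR_ge1Dx (expR (2 * lam) * (M / h) / F).
rewrite -(ler_pM2l F0); apply: le_trans; rewrite mulrDr mulr1.
by rewrite [F * _]mulrC divfK // gt_eqF.
Qed.

Variables (C f0 lam eps : R).
Hypotheses (C0 : 0 < C) (f00 : 0 < f0) (n0 : (0 < n)%N).
Hypothesis pn : 0 < p n.
Hypothesis hM : M <= C * (n%:R ^+ 2 * p n).
Hypothesis hF : f0 <= F.
Hypothesis lam0 : 0 <= lam.
(* The tilt [lam] may be taken large exactly because [k n p_n] tends to 0. *)
Hypothesis hk : m.+1%:R * n%:R * p n * expR (2 * lam) <= 1.

Let F0 : 0 < F. Proof. exact: lt_le_trans hF. Qed.

(** Truncation at h = n / 2^i. The bound on M and [hk] cancel m exp(2 lam) n p_n, leaving C 2^i / F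
    <= C 2^i / f0. *)
Lemma truncated_sum_tail (i : nat) (x : R) :
  \sum_(y : m.-tuple 'I_n.+1 | (x <= (sumn (nval y))%:R) &&
      all (fun a => a%:R <= n%:R / 2 ^+ i :> R) (nval y)) prodp p (nval y) <=
  F ^+ m * expR (C / f0 * 2 ^+ i - lam * (x / (n%:R / 2 ^+ i))).
Proof.
have nR : 0 < n%:R :> R by rewrite ltr0n.
have i0 : 0 < 2 ^+ i :> R by exact: exprn_gt0.
have h0 : 0 < n%:R / 2 ^+ i :> R by rewrite divr_gt0.
apply: (le_trans (truncated_chernoff _ _ x lam0 h0 F0)).
rewrite ler_pM2l ?exprn_gt0 // ler_expR lerD2r.
have hk' := hk; set q := 2 ^+ i in i0 *; set e := expR _ in hk' *.
have e0 : 0 < e by exact: expR_gt0.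
have M0 : 0 <= M by apply: sumr_ge0 => j _; rewrite mulr_ge0.
rewrite (_ : m%:R * _ = (m%:R * e * M) / (n%:R * F) * q); last first.
  by field; rewrite !gt_eqF.
rewrite ler_pM2r // ler_pdivrMr ?mulr_gt0 //.
apply: (@le_trans _ _ (C * n%:R)).
  apply: (@le_trans _ _ (m%:R * e * (C * (n%:R ^+ 2 * p n)))).
    by rewrite ler_wpM2l // mulr_ge0 // ltW.
  rewrite (_ : _ * _ = (m%:R * n%:R * p n * e) * (C * n%:R)); last by ring.
  rewrite -[leRHS]mul1r ler_pM2r ?mulr_gt0 //; apply: le_trans hk'.
  by rewrite !ler_pM2r // ler_nat.
rewrite [leRHS]mulrA (_ : C * _ = C / f0 * n%:R * f0); last by field; rewrite gt_eqF.
by rewrite ler_pM2l // mulr_gt0 // divr_gt0.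
Qed.

Hypothesis hB : forall j, (j <= n)%N -> j%:R ^+ 2 * p j <= C * (n%:R ^+ 2 * p n).
Hypothesis heps : 0 < eps <= 2^-1.
Hypothesis hlam : expR (C / f0 - lam / 2) <= 8^-1.

Lemma trunc_tail : \sum_(y : m.-tuple 'I_n.+1 | eps * n%:R < (sumn (nval y))%:R)
    prodp p (nval y) <= F ^+ m * expR (C / f0 - lam * eps).
Proof.
have nR : 0 < n%:R :> R by rewrite ltr0n.
have := truncated_sum_tail 0 (eps * n%:R); rewrite expr0 divr1 mulr1 mulfK ?gt_eqF //.
apply: le_trans; rewrite big_mkcond [leRHS]big_mkcond; apply: ler_sum => y _.
case: ifP => [h|_]; last by case: ifP => // _; exact: prodp_ge0.
rewrite (ltW h) /= ifT //; apply/allP => a /(allP (nval_le _ _ y)).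
by rewrite ler_nat.
Qed.

(** Lower bound on s in block i, equivalent to n - s <= n / 2^i when i > 0. For i = 0 that condition
    would be vacuous, so s > eps n is used instead. *)
Let threshold (i : nat) : R := if i is 0%N then eps * n%:R else n%:R - n%:R / 2 ^+ i.

(** For i > 0 the exponent is at most (C/f0 - lam/2) 2^i, since 2^i - 1 >= 2^i / 2, and the bracket
    is nonpositive. Using 2^i >= i + 1, one factor is compared with exp(C/f0 - lam eps), as eps <=
    1/2, and the others with 1/8. *)
Let block_bound (i : nat) :
  \sum_(y : m.-tuple 'I_n.+1 | (threshold i <= (sumn (nval y))%:R) &&
      all (fun a => a%:R <= n%:R / 2 ^+ i :> R) (nval y)) prodp p (nval y) <=
  F ^+ m * (expR (C / f0 - lam * eps) * 8^-1 ^+ i).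
Proof.
have nR : 0 < n%:R :> R by rewrite ltr0n.
apply: (le_trans (truncated_sum_tail _ _)); rewrite ler_pM2l ?exprn_gt0 //.
case: i => [|i]; first by rewrite /threshold !expr0 !mulr1 divr1 mulfK // gt_eqF.
have q0 : 0 < 2 ^+ i :> R by exact: exprn_gt0.
have q1 : i.+1%:R <= 2 ^+ i :> R by rewrite -natrX ler_nat ltn_expl.
rewrite /threshold (_ : (n%:R - _) / _ = 2 ^+ i.+1 - 1); last first.
  by rewrite exprS; field; rewrite !gt_eqF.
have hlam' := hlam; set c := C / f0 in hlam' *; have c0 : 0 < c by rewrite divr_gt0.
have c8 : c - lam / 2 <= 0.
  rewrite -ler_expR expR0; apply: (le_trans hlam'); lra.
apply: (@le_trans _ _ (expR ((c - lam / 2) * (i.+2)%:R))).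
  rewrite ler_expR exprS.
  have : i.+2%:R <= 2 * 2 ^+ i :> R.
    rewrite -addn1 natrD; have : 1 <= 2 ^+ i :> R by rewrite -natrX ler1n expn_gt0.
    lra.
  have h2 : 1 <= 2 ^+ i :> R by rewrite -natrX ler1n expn_gt0.
  nra.
rewrite expRM_natr exprS; apply: ler_pM; rewrite ?exprn_ge0 ?expR_ge0 //.
  rewrite ler_expR lerD2l lerN2 ler_wpM2l //; by move: heps => /andP[].
by apply: lerXn2r; rewrite ?nnegrE ?expR_ge0 ?invr_ge0.
Qed.

(** If n = s, all entries would vanish and n would be 0, so n - s > 0. In the block chosen, n /
    (n-s) < 2^(i+1), and [hB] at n - s yields the factor 4^(i+1). *)
Let block_exists (y : m.-tuple 'I_n.+1) (s := sumn (nval y)) :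
  (s <= n)%N -> all (fun a => a <= n - s)%N (nval y) -> eps * n%:R < s%:R ->
  exists i : 'I_n, [/\ threshold i <= s%:R,
    all (fun a => a%:R <= n%:R / 2 ^+ i :> R) (nval y) &
    p (n - s)%N <= C * p n * 4 ^+ i.+1].
Proof.
move=> sn yn es.
have nR : 0 < n%:R :> R by rewrite ltr0n.
have d0 : (0 < n - s)%N.
  rewrite lt0n; apply/negP => /eqP d0; rewrite d0 in yn.
  have s0 : s = 0%N.
    rewrite /s; elim: (nval y) yn => //= a r IH /andP[].
    by rewrite leqn0 => /eqP -> /IH ->.
  by move: d0 n0; rewrite s0 subn0 => ->.
have nd0 : (0 < n %/ (n - s))%N by rewrite divn_gt0 // leq_subr.
(* [i] is the index of the block [2 ^ i * (n - s) <= n < 2 ^ i.+1 * (n - s)]. *)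
pose i := trunc_log 2 (n %/ (n - s)).
have i1 : (2 ^ i * (n - s) <= n)%N.
  by apply: leq_trans (leq_divM n (n - s)); rewrite leq_mul2r trunc_logP ?orbT.
have i2 : (n < 2 ^ i.+1 * (n - s))%N by rewrite -ltn_divLR // trunc_log_ltn.
have i_n : (i < n)%N.
  apply: leq_trans (ltn_expl i (isT : (1 < 2)%N)) _; apply: leq_trans i1.
  by rewrite leq_pmulr.
have q0 : 0 < 2 ^+ i :> R by exact: exprn_gt0.
have dq : (n - s)%:R <= n%:R / 2 ^+ i :> R.
  by rewrite ler_pdivlMr // mulrC -natrX -natrM ler_nat.
exists (Ordinal i_n) => /=; split.
- move: dq; rewrite /threshold; case: (i) => [_|i' dq]; first exact: ltW.
  by move: dq; rewrite natrB //; lra.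
- by apply/allP => a /(allP yn) ha; apply: le_trans dq; rewrite ler_nat.
have dR : 0 < (n - s)%:R :> R by rewrite ltr0n.
rewrite -(ler_pM2l (exprn_gt0 2 dR)).
apply: (le_trans (hB _ (leq_subr _ _))).
rewrite (_ : _ ^+ 2 * (C * p n * _) = C * ((2 ^+ i.+1 * (n - s)%:R) ^+ 2 * p n)); last first.
  by rewrite (_ : 4 = 2 ^+ 2 :> R) -?exprM ?[(2 * _)%N]mulnC ?exprM; [ring|rewrite -natrX].
rewrite ler_pM2l // ler_pM2r //; apply: lerXn2r; rewrite ?nnegrE ?mulr_ge0 ?exprn_ge0 //.
by rewrite -natrX -natrM ler_nat ltnW.
Qed.

(** Summing over blocks, 4^(i+1) against 8^(-i) leaves 4 * 2^(-i), whose sum is at most 8. Blocks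
    may overlap, which is harmless for an upper bound. *)
Lemma bad_sum_le : \sum_(y : m.-tuple 'I_n.+1 | [&& (sumn (nval y) <= n)%N,
     all (fun a => a <= n - sumn (nval y))%N (nval y) & eps * n%:R < (sumn (nval y))%:R])
     prodp p (nval y) * p (n - sumn (nval y))%N <=
   8 * C * p n * F ^+ m * expR (C / f0 - lam * eps).
Proof.
pose blk (i : 'I_n) (y : m.-tuple 'I_n.+1) := (threshold i <= (sumn (nval y))%:R) &&
      all (fun a => a%:R <= n%:R / 2 ^+ i :> R) (nval y).
set B := expR (C / f0 - lam * eps).
apply: (@le_trans _ _ (\sum_(i < n) (C * p n * 4 ^+ i.+1) *
    \sum_(y : m.-tuple 'I_n.+1 | blk i y) prodp p (nval y))).
  under [leRHS]eq_bigr => i _ do rewrite big_mkcond mulr_sumr.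
  rewrite exchange_big big_mkcond /=; apply: ler_sum => y _.
  have term0 (j : 'I_n) : 0 <= C * p n * 4 ^+ j.+1 * (if blk j y then prodp p (nval y) else 0).
    apply: mulr_ge0; first by rewrite !mulr_ge0 ?exprn_ge0 // ltW.
    by case: ifP => // _; exact: prodp_ge0.
  case: ifP => [/and3P[h1 h2 h3]|_]; last exact: sumr_ge0.
  have [i [t1 t2 t3]] := block_exists _ h1 h2 h3.
  rewrite (bigD1 i) //= -[leLHS]addr0; apply: lerD; last exact: sumr_ge0.
  by rewrite /blk t1 t2 mulrC ler_wpM2r // prodp_ge0.
apply: (@le_trans _ _ (\sum_(i < n) 4 * C * p n * F ^+ m * B * 2^-1 ^+ i)).
  apply: ler_sum => i _.
  apply: (@le_trans _ _ (C * p n * 4 ^+ i.+1 * (F ^+ m * (B * 8^-1 ^+ i)))).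
    by apply: ler_wpM2l; [rewrite !mulr_ge0 ?exprn_ge0 // ltW|exact: block_bound].
  rewrite le_eqVlt; apply/orP; left; apply/eqP; rewrite (_ : 2^-1 = 4 * 8^-1 :> R); last by field.
  by rewrite exprMn exprS; ring.
rewrite -mulr_sumr.
have A0 : 0 <= 4 * C * p n * F ^+ m * B by rewrite !mulr_ge0 ?exprn_ge0 ?expR_ge0 // ltW.
have geo : \sum_(i < n) 2^-1 ^+ i <= 2 :> R.
  have := subrX1 (2^-1 : R) n.
  have : 0 <= 2^-1 ^+ n :> R by rewrite exprn_ge0.
  lra.
have := ler_wpM2l A0 geo; lra.
Qed.

End truncated_chernoff.

(** * Comparison of the laws *)

(** Points with an entry above n contribute nothing, so the infinite sum becomes a sum over a finite
    type. *)
Lemma dTV_tuples (R : realType) (m n : nat) (P Q : seq nat -> R) :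
  (forall s, size s = m -> ~~ all (fun a => a <= n)%N s -> P s = Q s) ->
  dTV m P Q = (2^-1 * \sum_(y : m.-tuple 'I_n.+1) `|P (nval y) - Q (nval y)|)%:E.
Proof.
move=> PQ; pose r : seq (seq nat) := [seq nval y | y <- enum {: m.-tuple 'I_n.+1}].
have ur : uniq r by rewrite map_inj_uniq ?enum_uniq //; exact: nval_inj.
have rE : [set y : seq nat | size y = m] `&` [set` r] = [set` r].
  by apply/setIidr => s /= /mapP[y _ ->]; exact: size_nval.
rewrite /dTV EFinM; congr (_ * _)%E.
rewrite (eq_esum (b := fun y => if y \in [set` r] then (`|P y - Q y|)%:E else 0%E)); last first.
  move=> s /= sm; case: ifPn => // /negP sr; rewrite (PQ s sm) ?subrr ?normr0 //.
  apply/negP => /(nval_surj _ _ _ sm)[y ys]; apply: sr; rewrite inE /= -ys.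
  by apply: map_f; rewrite mem_enum.
rewrite -esum_mkcondr rE esum_fset; first last.
- by move=> y _; rewrite lee_fin.
- exact: finite_seq.
by rewrite -fsbig_seq // big_map big_enum /= sumEFin.
Qed.

(** For equal total masses the sum of |P - Q| is twice that of the positive part of Q - P. Hence a
    lower bound on P off the bad set suffices. *)
Lemma sum_dist_le (R : realType) (I : finType) (P Q : I -> R) (bad : pred I) (d : R) :
  \sum_i P i = \sum_i Q i -> (forall i, 0 <= P i) -> (forall i, 0 <= Q i) -> 0 <= d ->
  (forall i, ~~ bad i -> (1 - d) * Q i <= P i) ->
  \sum_i `|P i - Q i| <= 2 * (d * \sum_i Q i + \sum_(i | bad i) Q i).
Proof.
move=> PQ P0 Q0 d0 good.
have -> : 2 * (d * \sum_i Q i + \sum_(i | bad i) Q i) =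
    \sum_i (P i - Q i + 2 * (d * Q i + if bad i then Q i else 0)).
  rewrite big_split /= sumrB PQ subrr add0r -mulr_sumr big_split /= -mulr_sumr.
  by rewrite -big_mkcond.
apply: ler_sum => i _; have p0 := P0 i; have q0 := Q0 i.
have dq : 0 <= d * Q i by rewrite mulr_ge0.
rewrite ler_norml; case: ifPn => [_|/good h]; apply/andP; split; nra.
Qed.

Lemma ltn_sub_quarter (a s n : nat) :
  (0 < n)%N -> (4 * s <= n)%N -> (a <= s)%N -> (a < n - s)%N.
Proof. by lia. Qed.

Section fixed_size.
Variables (R : realType) (p : nat -> R) (m n : nat) (d eps : R).
Hypotheses (p0 : forall j, 0 <= p j) (n0 : (0 < n)%N) (pn : 0 < p n).
Let F := \sum_(j < n.+1) p j.
Hypotheses (F0 : 0 < F) (d0 : 0 < d <= 8^-1) (heps : 0 < eps <= 4^-1).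
Hypothesis hloc : forall s : nat, s%:R <= eps * n%:R ->
  (1 - d) * p n <= p (n - s)%N <= (1 + d) * p n.
Hypothesis htail : \sum_(y : m.-tuple 'I_n.+1 | eps * n%:R < (sumn (nval y))%:R)
    prodp p (nval y) <= d * F ^+ m.
Hypothesis hbad : \sum_(y : m.-tuple 'I_n.+1 | [&& (sumn (nval y) <= n)%N,
     all (fun a => a <= n - sumn (nval y))%N (nval y) & eps * n%:R < (sumn (nval y))%:R])
     prodp p (nval y) * p (n - sumn (nval y))%N <= d * (p n * F ^+ m).

(** [J y] is P(tau = y, S_k = n), [Z] is P(S_k = n), and [K] is the value k p_n F^m to which [Z] is
    compared. *)
Let J (y : m.-tuple 'I_n.+1) : R :=
  (ninsert m n (nval y))%:R * (prodp p (nval y) * p (n - sumn (nval y))%N).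
Let Z := \sum_(t : m.+1.-tuple 'I_n.+1 | sumn (nval t) == n) prodp p (nval t).
Let K := m.+1%:R * (p n * F ^+ m).
Let far (y : m.-tuple 'I_n.+1) := eps * n%:R < (sumn (nval y))%:R.

Let ZE : Z = \sum_y J y.
Proof.
by rewrite -(sum_tau_fibers m n R p xpredT); apply: eq_bigl => t; rewrite andbT.
Qed.

Let K0 : 0 < K.
Proof. by rewrite !mulr_gt0 // exprn_gt0. Qed.

Let J0 y : 0 <= J y.
Proof. by rewrite !mulr_ge0 // prodp_ge0. Qed.

(** Off [far] the total s is at most n/4, so every entry is at most s < n - s and all m + 1
    insertions are valid. *)
Let JnearE y : ~~ far y -> J y = m.+1%:R * (prodp p (nval y) * p (n - sumn (nval y))%N).
Proof.
rewrite /far -leNgt => sy; rewrite /J ninsert_full ?size_nval //.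
  rewrite -(ler_nat R); apply: (le_trans sy).
  by rewrite -[leRHS]mul1r ler_wpM2r //; move: heps => /andP[_]; lra.
have s4 : (4 * sumn (nval y) <= n)%N.
  rewrite -(ler_nat R) natrM; have : eps * n%:R <= 4^-1 * n%:R by rewrite ler_wpM2r //; case/andP: heps.
  by lra.
apply/allP => a /leq_sumn; move: n0 s4; exact: ltn_sub_quarter.
Qed.

Let sum_prodp : \sum_(y : m.-tuple 'I_n.+1) prodp p (nval y) = F ^+ m.
Proof. exact: sum_prodp_nval. Qed.

(** A nonzero [ninsert] forces exactly the constraints on y in [hbad], and it is at most m + 1. *)
Let sum_far : \sum_(y | far y) J y <= d * K.
Proof.
rewrite /K mulrCA; apply: le_trans (ler_wpM2l (ler0n R m.+1) hbad).
rewrite mulr_sumr [leLHS]big_mkcond [leRHS]big_mkcond /=; apply: ler_sum => y _.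
case: ifPn => [fy|_]; last first.
  by case: ifP => // _; rewrite !mulr_ge0 // prodp_ge0.
rewrite -/(far y) fy andbT /J.
case: (posnP (ninsert m n (nval y))) => [->|/ninsert_gt0[-> ->]] /=.
  by rewrite mul0r; case: ifP => // _; rewrite !mulr_ge0 // prodp_ge0.
by rewrite ler_wpM2r ?mulr_ge0 ?prodp_ge0 // ler_nat ninsert_le.
Qed.

Let near_bounds y : ~~ far y ->
  (1 - d) * (m.+1%:R * p n) * prodp p (nval y) <= J y <=
  (1 + d) * (m.+1%:R * p n) * prodp p (nval y).
Proof.
move=> fy; rewrite (JnearE _ fy).
have /andP[h1 h2] : (1 - d) * p n <= p (n - sumn (nval y))%N <= (1 + d) * p n.
  by apply: hloc; rewrite leNgt.
have pp := prodp_ge0 _ p (nval y) p0.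
have e (x : R) : x * (m.+1%:R * p n) * prodp p (nval y) =
  m.+1%:R * (prodp p (nval y) * (x * p n)) by ring.
by rewrite !e; apply/andP; split; rewrite ler_wpM2l ?ler0n // ler_wpM2l.
Qed.

(** One factor 1 - d comes from the local estimate of p_(n-s), the other from discarding the far
    points. *)
Let Z_ge : (1 - d) * (1 - d) * K <= Z.
Proof.
case/andP: d0 => d1 d2.
rewrite ZE (bigID far) /=; apply: ler_wpDl; first exact: sumr_ge0.
apply: (@le_trans _ _ (\sum_(y | ~~ far y) (1 - d) * (m.+1%:R * p n) * prodp p (nval y))).
  rewrite -mulr_sumr (_ : _ * K = (1 - d) * (m.+1%:R * p n) * ((1 - d) * F ^+ m)); last first.
    by rewrite /K; ring.
  apply: ler_wpM2l; first by rewrite !mulr_ge0 //; lra.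
  have := sum_prodp; rewrite (bigID far) /=; have := htail; rewrite -/far; lra.
by apply: ler_sum => y /near_bounds/andP[].
Qed.

Let Z_le : Z <= (1 + 2 * d) * K.
Proof.
case/andP: d0 => d1 d2.
rewrite ZE (bigID far) /=.
have h : \sum_(y | ~~ far y) J y <= (1 + d) * (m.+1%:R * p n) * F ^+ m.
  apply: (@le_trans _ _ (\sum_(y | ~~ far y) (1 + d) * (m.+1%:R * p n) * prodp p (nval y))).
    by apply: ler_sum => y /near_bounds/andP[].
  rewrite -mulr_sumr -sum_prodp ler_wpM2l //.
    by rewrite !mulr_ge0 //; lra.
  rewrite [leRHS](bigID far) /= lerDr; apply: sumr_ge0 => y _; exact: prodp_ge0.
have hK : (1 + d) * (m.+1%:R * p n) * F ^+ m = (1 + d) * K by rewrite /K; ring.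
have := sum_far; lra.
Qed.

Let Z0 : 0 < Z.
Proof.
apply: lt_le_trans Z_ge; case/andP: d0 => d1 d2.
by apply: mulr_gt0 => //; apply: mulr_gt0; lra.
Qed.

(** As the maximum is n - s, its relative deviation is s / n, so exceeding e >= eps means [far]. The
    far mass d K is at most 2 d Z because (1 - d)^2 >= 1/2. *)
Lemma condSum_far_le (e : R) : eps <= e ->
  condSum p m.+1 n (fun x => e < `|(\max_(i <- x) i)%N%:R / n%:R - 1|) <= 2 * d.
Proof.
move=> ee; case/andP: d0 => d1 d2.
rewrite /condSum -/Z ler_pdivrMr //.
apply: (@le_trans _ _ (d * K)); last first.
  have h2 : 2^-1 <= (1 - d) * (1 - d) by nra.
  have h3 : 2^-1 * K <= (1 - d) * (1 - d) * K by rewrite ler_wpM2r // ltW.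
  have h4 : K <= 2 * Z by have := Z_ge; lra.
  by rewrite [2 * d]mulrC -mulrA ler_wpM2l // ltW.
apply: le_trans sum_far.
rewrite (sum_tau_fibers m n R p (fun M => e < `|M%:R / n%:R - 1|)).
rewrite big_mkcond [leRHS]big_mkcond /=; apply: ler_sum => y _.
have nR : 0 < n%:R :> R by rewrite ltr0n.
case: ifP => [h|_]; last by case: ifP.
rewrite ifT //; rewrite /far; apply: contraLR h; rewrite -!leNgt => sy.
apply: le_trans ee.
have sn : (sumn (nval y) <= n)%N.
  rewrite -(ler_nat R); apply: (le_trans sy).
  by rewrite -[leRHS]mul1r ler_wpM2r //; move: heps => /andP[_]; lra.
rewrite natrB // mulrBl divff ?gt_eqF // addrAC subrr add0r normrN.
by rewrite ger0_norm ?divr_ge0 // ler_pdivrMr.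
Qed.

Lemma dTV_tau_le :
  (dTV m (lawTauCond p m.+1 n) (lawTrunc p m n) <= (4 * d)%:E)%E.
Proof.
case/andP: d0 => d1 d2.
have lawP s : lawTauCond p m.+1 n s =
    (ninsert m n s)%:R * (prodp p s * p (n - sumn s)%N) / Z.
  by rewrite /lawTauCond /condSum (sum_tau_fiber m n R p).
rewrite (dTV_tuples R m n); last first.
  move=> s sm sn; rewrite lawP /lawTrunc (negbTE sn) andbF mul0r.
  case: (posnP (ninsert m n s)) => [->|/ninsert_gt0[_ /allP h]]; first by rewrite !mul0r.
  by case/negP: sn; apply/allP => a /h h'; apply: (leq_trans h'); exact: leq_subr.
have lawQ (y : m.-tuple 'I_n.+1) : lawTrunc p m n (nval y) = prodp p (nval y) / F ^+ m.
  by rewrite /lawTrunc size_nval eqxx nval_le /= sum_prodp.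
rewrite lee_fin.
have Fm : 0 < F ^+ m by exact: exprn_gt0.
have Q1 : \sum_(y : m.-tuple 'I_n.+1) lawTrunc p m n (nval y) = 1.
  under eq_bigr => y _ do rewrite lawQ.
  by rewrite -mulr_suml sum_prodp divff // gt_eqF.
have P1 : \sum_(y : m.-tuple 'I_n.+1) lawTauCond p m.+1 n (nval y) = 1.
  under eq_bigr => y _ do rewrite lawP -/(J y).
  by rewrite -mulr_suml -ZE divff // gt_eqF.
have ht : \sum_(y | far y) lawTrunc p m n (nval y) <= d.
  under eq_bigr => y _ do rewrite lawQ.
  by rewrite -mulr_suml ler_pdivrMr.
suff : \sum_(y : m.-tuple 'I_n.+1) `|lawTauCond p m.+1 n (nval y) - lawTrunc p m n (nval y)|
    <= 2 * (3 * d * 1 + \sum_(y | far y) lawTrunc p m n (nval y)) by lra.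
rewrite -[X in 3 * d * X]Q1; apply: sum_dist_le; first by rewrite P1 Q1.
- by move=> y; rewrite lawP -/(J y) divr_ge0 // ltW.
- by move=> y; rewrite lawQ divr_ge0 ?prodp_ge0 // ltW.
- lra.
(* The constant 3d arises from (1 - 3d) Z <= (1 - 3d)(1 + 2d) K <= (1 - d) K. With the tail mass d,
   half of the distance sum is at most 4d. *)
- move=> y /near_bounds/andP[h _]; rewrite lawP -/(J y) lawQ ler_pdivlMr //.
  apply: le_trans h.
  have pp := prodp_ge0 _ p (nval y) p0.
  have -> : (1 - 3 * d) * (prodp p (nval y) / F ^+ m) * Z =
     ((1 - 3 * d) * Z / F ^+ m) * prodp p (nval y) by ring.
  apply: ler_wpM2r => //; rewrite ler_pdivrMr // -mulrA -[(_ * p n) * _]mulrA.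
  rewrite -[m.+1%:R * _]/K; have kk := K0; have := Z_le; nra.
Qed.

End fixed_size.

(** Order of choices: d and e fix eps, these fix eta and then the tilt lam, and only then is n taken
    large enough for k n p_n exp(2 lam) <= 1. *)
Lemma eventually_close (R : realType) (p : nat -> R) (k : nat -> nat) (d e : R) :
  (forall n, 0 <= p n) -> nearly_harmonic p -> (forall n, (0 < k n)%N) ->
  (fun n => (k n)%:R * (n%:R * p n)) @ \oo --> (0 : R) ->
  0 < d <= 8^-1 -> 0 < e ->
  \forall n \near \oo,
    (dTV (k n).-1 (lawTauCond p (k n) n) (lawTrunc p (k n).-1 n) <= (4 * d)%:E)%E /\
    condSum p (k n) n (fun x => e < `|(\max_(i <- x) i)%N%:R / n%:R - 1|) <= 2 * d.
Proof.
move=> p0 hp k0 hk dd e0; case/andP: (dd) => d0 d8.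
have [C1 C10 [N1 hN1]] := nearly_harmonic_le _ _ p0 hp.
have [C2 C20 [N2 hN2]] := nearly_harmonic_sum _ _ p0 hp.
have [N3 hN3] := nearly_harmonic_gt0 _ _ hp.
have [eps1 /andP[eps10 eps14] [N4 hN4]] := nearly_harmonic_local _ _ p0 hp _ d0.
pose eps := Num.min eps1 e.
have eps0 : 0 < eps by rewrite lt_min eps10.
have eps_eps1 : eps <= eps1 by rewrite ge_min lexx.
have eps_e : eps <= e by rewrite ge_min lexx orbT.
clearbody eps.
pose C := C1 + C2; have C0 : 0 < C by rewrite addr_gt0.
(* A single positive term bounds F from below uniformly in n >= N3. *)
pose f0 := p N3; have f00 : 0 < f0 by exact: hN3.
(* The first bound serves the tail estimate and [hlam]; the second absorbs the prefactor 8C of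
   [bad_sum_le]. *)
pose eta := Num.min d (d / (8 * C)).
have eta0 : 0 < eta by rewrite lt_min d0 divr_gt0 // mulr_gt0.
have eta_d : eta <= d by rewrite ge_min lexx.
have eta_C : 8 * C * eta <= d.
  rewrite mulrC -ler_pdivlMr ?mulr_gt0 //; by rewrite ge_min lexx orbT.
(* The least nonnegative tilt for which exp(C/f0 - lam eps) <= eta. *)
pose lam := Num.max 0 ((C / f0 - ln eta) / eps).
have lam0 : 0 <= lam by rewrite le_max lexx.
have lam_eps : C / f0 - lam * eps <= ln eta.
  rewrite lerBlDr addrC -lerBlDr -ler_pdivrMr //.
  by rewrite le_max lexx orbT.
have B_eta : expR (C / f0 - lam * eps) <= eta.
  by rewrite -[leRHS](@lnK _ eta) ?posrE // ler_expR.
have q8 : expR (C / f0 - lam / 2) <= 8^-1.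
  apply: le_trans d8; apply: le_trans eta_d; apply: le_trans B_eta.
  by rewrite ler_expR lerD2l lerN2 ler_wpM2l //; lra.
clearbody lam eta.
have /cvgrPdist_lt/(_ (expR (- (2 * lam))) (expR_gt0 _))[N5 _ hN5] := hk.
exists (maxn (maxn (maxn N1 N2) (maxn N3 N4)) N5).+1 => // n /= hn.
move: hn; rewrite !gtn_max => /andP[/andP[/andP[/ltnW n1 /ltnW n2] /andP[/ltnW n3 /ltnW n4]] n5].
have n0 : (0 < n)%N by exact: leq_ltn_trans n5.
have pn : 0 < p n by exact: hN3.
have np : 0 <= n%:R ^+ 2 * p n by rewrite mulr_ge0 // exprn_ge0.
have hC1 : C1 * (n%:R ^+ 2 * p n) <= C * (n%:R ^+ 2 * p n).
  by rewrite ler_wpM2r // lerDl ltW.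
have hC2 : C2 * (n%:R ^+ 2 * p n) <= C * (n%:R ^+ 2 * p n).
  by rewrite ler_wpM2r // lerDr ltW.
have hM : \sum_(j < n.+1) j%:R * p j <= C * (n%:R ^+ 2 * p n).
  by apply: le_trans hC2; exact: hN2.
have hB j : (j <= n)%N -> j%:R ^+ 2 * p j <= C * (n%:R ^+ 2 * p n).
  by move=> jn; apply: le_trans hC1; exact: hN1.
have hF : f0 <= \sum_(j < n.+1) p j.
  have N3n : (N3 < n.+1)%N by exact: n3.
  by rewrite (bigD1 (Ordinal N3n)) //= lerDl; apply: sumr_ge0.
have F0 := lt_le_trans f00 hF.
have hkn : (k n)%:R * n%:R * p n * expR (2 * lam) <= 1.
  have := hN5 n; rewrite sub0r normrN ger0_norm ?mulr_ge0 // => /(_ _)/ltW h.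
  rewrite -ler_pdivlMr ?expR_gt0 // mul1r -expRN -mulrA; apply: h; exact: ltnW.
have hloc (s : nat) : s%:R <= eps * n%:R -> (1 - d) * p n <= p (n - s)%N <= (1 + d) * p n.
  move=> sn; apply: hN4 => //.
  by apply: (le_trans sn); rewrite ler_wpM2r.
have eps2 : 0 < eps <= 2^-1 by rewrite eps0 /=; lra.
have eps4 : 0 < eps <= 4^-1 by rewrite eps0 /=; lra.
move: (k n) (k0 n) hkn => [//|m] _ hkn /=.
have hT := @trunc_tail R p m n p0 C f0 lam eps C0 f00 n0 pn hM hF lam0 hkn.
have hbad := @bad_sum_le R p m n p0 C f0 lam eps C0 f00 n0 pn hM hF lam0 hkn hB eps2 q8.
set F := \sum_(j < n.+1) p j in hF F0 hT hbad.
have Fm : 0 <= F ^+ m by rewrite exprn_ge0 // ltW.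
have {}hT : \sum_(y : m.-tuple 'I_n.+1 | eps * n%:R < (sumn (nval y))%:R)
    prodp p (nval y) <= d * F ^+ m.
  by apply: (le_trans hT); rewrite mulrC ler_wpM2r // (le_trans B_eta).
set B := expR (C / f0 - lam * eps) in hbad B_eta.
have hB' : 8 * C * p n * F ^+ m * B <= d * (p n * F ^+ m).
  rewrite (_ : _ * B = 8 * C * B * (p n * F ^+ m)); last by ring.
  rewrite ler_wpM2r ?mulr_ge0 //; apply: le_trans eta_C.
  by rewrite ler_wpM2l // mulr_ge0 // ltW.
have {}hbad := le_trans hbad hB'.
by split; [exact: (@dTV_tau_le R p m n d eps)|exact: (@condSum_far_le R p m n d eps)].
Qed.

Lemma dTV_ge0 (R : realType) (m : nat) (P Q : seq nat -> R) : (0 <= dTV m P Q)%E.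
Proof.
by rewrite /dTV mule_ge0 ?lee_fin ?invr_ge0 //; apply: esum_ge0 => y _; rewrite lee_fin.
Qed.

Theorem theorem2p3 (R : realType) (w : nat -> R) (rho : R) (L : R -> R)
    (k : nat -> nat) :
  (forall n, 0 <= w n) ->
  0 < rho ->
  slowly_varying L ->
  (fun n => w n / (L n%:R * n%:R^-1 * rho ^- n)) @ \oo --> (1 : R) ->
  cvgn (series (fun n => w n * rho ^+ n)) ->
  0 < Wat w rho ->
  (forall n, (0 < k n)%N) ->
  (fun n => (k n)%:R * L n%:R) @ \oo --> (0 : R) ->
  (fun n => dTV (k n).-1 (lawTauCond (pX w rho) (k n) n)
                         (lawTrunc (pX w rho) (k n).-1 n)) @ \oo --> (0 : \bar R)
  /\
  (forall eps : R, 0 < eps ->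
     (fun n => condSum (pX w rho) (k n) n
        (fun x => eps < `| (\max_(i <- x) i)%N%:R / n%:R - 1 |)) @ \oo --> (0 : R)).
Proof.
move=> w0 rho0 svL wL _ W0 k0 kL.
have p0 n : 0 <= pX w rho n by rewrite /pX divr_ge0 ?mulr_ge0 ?exprn_ge0 // ltW.
have hp := pX_nearly_harmonic _ w rho L rho0 svL wL W0.
(* Here k n p_n is k L(n) times a factor converging to 1 / W(rho), so it inherits the limit 0. *)
have hk : (fun n => (k n)%:R * (n%:R * pX w rho n)) @ \oo --> (0 : R).
  have [N hN] := pX_eventuallyE _ w rho L rho0 svL W0.
  have : (fun n => w n / (L n%:R * n%:R^-1 * rho ^- n) * ((k n)%:R * L n%:R) / Wat w rho)
      @ \oo --> (1 * 0 / Wat w rho : R).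
    by apply: cvgM; [exact: cvgM|exact: cvg_cst].
  rewrite mulr0 mul0r; apply: cvg_trans; apply: near_eq_cvg.
  exists N => // n /= /hN[_ ->].
  by ring.
have close := eventually_close R _ k _ _ p0 hp k0 hk.
split.
  have bound (c : R) : 0 < c -> \forall n \near \oo,
      (0 <= dTV (k n).-1 (lawTauCond (pX w rho) (k n) n) (lawTrunc (pX w rho) (k n).-1 n)
       <= c%:E)%E.
    move=> c0; pose d := Num.min (8^-1) (c / 4).
    have d0 : 0 < d <= 8^-1 by rewrite lt_min ge_min lexx /= andbT; apply/andP; split; lra.
    have dc : d <= c / 4 by rewrite ge_min lexx orbT.
    have := close _ _ d0 ltr01; apply: filterS => n [h _].
    apply/andP; split; first exact: dTV_ge0.
    by apply: (le_trans h); rewrite lee_fin; lra.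
  (* Convergence in the extended reals reduces to real convergence once the distance is eventually
     finite, which the bound with c = 1 ensures. *)
  apply: cvg_EFin.
    have := bound 1 ltr01; apply: filterS => n /andP[h1 h2].
    by rewrite ge0_fin_numE // (le_lt_trans h2) // ltry.
  apply/cvgr0Pnorm_le => c /bound; apply: filterS => n /=.
  move=> /andP[h1 h2]; rewrite ger0_norm ?fine_ge0 // -lee_fin fineK //.
  by rewrite ge0_fin_numE // (le_lt_trans h2) // ltry.
move=> e e0; apply/cvgr0Pnorm_le => d d0.
pose d' := Num.min (8^-1) (d / 2).
have d'0 : 0 < d' <= 8^-1 by rewrite lt_min ge_min lexx /= andbT; apply/andP; split; lra.
have d'd : d' <= d / 2 by rewrite ge_min lexx orbT.
have := close _ _ d'0 e0; apply: filterS => n [_ h].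
rewrite ger0_norm; first lra.
by rewrite /condSum divr_ge0 // sumr_ge0 // => t _; apply: prodp_ge0.
Qed.
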